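(* For all integers $t\ge 1$ and $N\ge 0$, $$MO(-1,t;3N+2)\equiv 0\pmod 2.$$
   Context: For an integer $a$ and a nonnegative integer $t$, define $MO(a,t;n)$ by the formal power series identity $$\sum_{n\ge 0}MO(a,t;n)\,q^n=\sum_{1\le n_1<n_2<\cdots<n_t}\frac{q^{n_1+n_2+\cdots+n_t}}{\prod_{k=1}^t(1+aq^{n_k}+q^{2n_k})},$$ where each factor $1/(1+aq^{m}+q^{2m})$ is expanded as a power series in $q$ with integer coefficients. *)

(* Defs.v *)
From HB Require Import structures.
From mathcomp Require Import all_boot all_order all_algebra.
From mathcomp Require Import boolp classical_sets functions cardinality fsbigop.

Set Implicit Arguments.
Unset Strict Implicit.
Unset Printing Implicit Defensive.

Import GRing.Theory.
Local Open Scope ring_scope.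

(* A record rather than the bare function type [nat -> R], which carries the
   pointwise product. *)
Record fps (R : Type) := Fps { fcoef : nat -> R }.

Notation "{ 'fps' R }" := (fps R) (at level 0, format "{ 'fps'  R }").

Lemma fpsP (R : Type) (f g : {fps R}) : fcoef f =1 fcoef g -> f = g.
Proof. by case: f g => [f] [g] /= /funext ->. Qed.

HB.instance Definition _ (R : Type) := gen_eqMixin {fps R}.
HB.instance Definition _ (R : Type) := gen_choiceMixin {fps R}.

Section FpsRing.
Variable R : comUnitRingType.
Implicit Types f g h : {fps R}.

Definition fps_zero : {fps R} := Fps (fun=> 0).
Definition fps_opp f : {fps R} := Fps (fun n => - fcoef f n).
Definition fps_add f g : {fps R} := Fps (fun n => fcoef f n + fcoef g n).
Definition fps_one : {fps R} := Fps (fun n => (n == 0%N)%:R).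
Definition fps_mul f g : {fps R} :=
  Fps (fun n => \sum_(i < n.+1) fcoef f i * fcoef g (n - i)).

Fact fps_addA : associative fps_add.
Proof. by move=> f g h; apply: fpsP => n /=; rewrite addrA. Qed.
Fact fps_addC : commutative fps_add.
Proof. by move=> f g; apply: fpsP => n /=; rewrite addrC. Qed.
Fact fps_add0 : left_id fps_zero fps_add.
Proof. by move=> f; apply: fpsP => n /=; rewrite add0r. Qed.
Fact fps_addN : left_inverse fps_zero fps_opp fps_add.
Proof. by move=> f; apply: fpsP => n /=; rewrite addNr. Qed.

HB.instance Definition _ :=
  GRing.isZmodule.Build {fps R} fps_addA fps_addC fps_add0 fps_addN.

Definition fps_trunc n f : {poly R} := \poly_(i < n) fcoef f i.

Lemma coef_fps_trunc n f i :
  (i < n)%N -> (fps_trunc n f)`_i = fcoef f i.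
Proof. by move=> ltin; rewrite coef_poly ltin. Qed.

Lemma fps_mul_trunc n f g i : (i < n)%N ->
  fcoef (fps_mul f g) i = (fps_trunc n f * fps_trunc n g)`_i.
Proof.
move=> ltin; rewrite coefM /=; apply: eq_bigr => j _.
rewrite !coef_fps_trunc //; first exact: leq_ltn_trans (leq_subr _ _) ltin.
by apply: leq_ltn_trans ltin; rewrite -ltnS.
Qed.

Fact fps_mulC : commutative fps_mul.
Proof.
by move=> f g; apply: fpsP => n; rewrite !(@fps_mul_trunc n.+1) // mulrC.
Qed.
Fact fps_mulA : associative fps_mul.
Proof.
move=> f g h; apply: fpsP => n.
transitivity ((fps_trunc n.+1 f * fps_trunc n.+1 g * fps_trunc n.+1 h)`_n).
  rewrite -mulrA coefM; apply: eq_bigr => i _.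
  by rewrite coef_fps_trunc // (@fps_mul_trunc n.+1) // ltnS leq_subr.
rewrite coefM; apply: eq_bigr => i _.
by rewrite coef_fps_trunc ?ltnS ?leq_subr // (@fps_mul_trunc n.+1).
Qed.
Fact fps_mul1 : left_id fps_one fps_mul.
Proof.
move=> f; apply: fpsP => n /=.
rewrite big_ord_recl /= mul1r subn0 big1 ?addr0 // => i _.
by rewrite mul0r.
Qed.
Fact fps_mulD : left_distributive fps_mul fps_add.
Proof.
move=> f g h; apply: fpsP => n /=; rewrite -big_split /=.
by apply: eq_bigr => i _; rewrite mulrDl.
Qed.
Fact fps_one_neq0 : fps_one != 0.
Proof.
by apply/eqP => /(congr1 (@fcoef R))/(congr1 (@^~ 0%N))/eqP; rewrite oner_eq0.
Qed.

HB.instance Definition _ := GRing.Zmodule_isComNzRing.Build {fps R}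
  fps_mulA fps_mulC fps_mul1 fps_mulD fps_one_neq0.

(* [fps_inv_seq f n] lists the first [n] coefficients of [1 / f], each obtained
   by solving \sum_(i <= n) f_(n - i) (1 / f)_i = (n == 0) for (1 / f)_n. *)
Fixpoint fps_inv_seq f (n : nat) : seq R :=
  if n is m.+1 then
    let s := fps_inv_seq f m in
    rcons s ((fcoef f 0)^-1 *
             ((m == 0%N)%:R - \sum_(i < m) fcoef f (m - i) * s`_i))
  else [::].

Definition fps_unit : {pred {fps R}} :=
  fun f => fcoef f 0 \is a GRing.unit.
Definition fps_inv f : {fps R} :=
  if f \in fps_unit then Fps (fun n => (fps_inv_seq f n.+1)`_n) else f.

Lemma size_fps_inv_seq f n : size (fps_inv_seq f n) = n.
Proof. by elim: n => //= n IHn; rewrite size_rcons IHn. Qed.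

Lemma nth_fps_inv_seq f n i :
  (i < n)%N -> (fps_inv_seq f n)`_i = (fps_inv_seq f i.+1)`_i.
Proof.
elim: n => // n IHn; rewrite ltnS leq_eqVlt => /predU1P[-> //|ltin].
by rewrite -IHn //= nth_rcons size_fps_inv_seq ltin.
Qed.

Fact fps_mulV : {in fps_unit, left_inverse 1 fps_inv *%R}.
Proof.
move=> f Uf; rewrite mulrC; apply: fpsP => n.
rewrite /fps_inv Uf [LHS]/= (reindex_inj rev_ord_inj) /=.
under eq_bigr => i _ do rewrite subSS subKn -1?ltnS //.
rewrite big_ord_recr /= subnn nth_rcons size_fps_inv_seq ltnn eqxx.
rewrite mulVKr // addrC -[RHS](subrK (\sum_(i < n) fcoef f (n - i) *
  (fps_inv_seq f n)`_i)); congr (_ + _).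
by apply: eq_bigr => i _; rewrite -/(fps_inv_seq f i.+1) -(@nth_fps_inv_seq f n).
Qed.
Fact fps_unitPl f g : g * f = 1 -> fps_unit f.
Proof.
move=> /(congr1 (@fcoef R))/(congr1 (@^~ 0%N)); rewrite /= big_ord1 => gf1.
by apply/unitrPr; exists (fcoef g 0); rewrite mulrC.
Qed.
Fact fps_inv_out : {in [predC fps_unit], fps_inv =1 id}.
Proof. by move=> f; rewrite inE /= /fps_inv => /negbTE ->. Qed.

HB.instance Definition _ := GRing.ComNzRing_hasMulInverse.Build {fps R}
  fps_mulV fps_unitPl fps_inv_out.

Definition fpsX : {fps R} := Fps (fun n => (n == 1%N)%:R).

Lemma fcoefD f g n : fcoef (f + g) n = fcoef f n + fcoef g n.
Proof. by []. Qed.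
Lemma fcoefM f g n :
  fcoef (f * g) n = \sum_(i < n.+1) fcoef f i * fcoef g (n - i).
Proof. by []. Qed.
Lemma fcoef1 n : fcoef (1 : {fps R}) n = (n == 0%N)%:R.
Proof. by []. Qed.
Lemma fps_unitE f : (f \is a GRing.unit) = (fcoef f 0 \is a GRing.unit).
Proof. by []. Qed.

Lemma fcoefXn m n : fcoef (fpsX ^+ m) n = (n == m)%:R.
Proof.
elim: m n => [|m IHm] n; first by [].
rewrite exprS fcoefM; case: n => [|n]; first by rewrite big_ord1 mul0r.
rewrite !big_ord_recl big1 => [|i _]; last by rewrite /= mul0r.
by rewrite /= mul0r add0r mul1r addr0 /bump /= subSS subn0 IHm eqSS.
Qed.

Lemma fcoefMn f k n : fcoef (f *+ k) n = fcoef f n *+ k.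
Proof. by elim: k => // k IHk; rewrite !mulrS fcoefD IHk. Qed.

Lemma fcoefN f n : fcoef (- f) n = - fcoef f n.
Proof. by []. Qed.

Lemma fcoefMz f (z : int) n : fcoef (f *~ z) n = fcoef f n *~ z.
Proof. by case: z => k; rewrite ?NegzE ?mulrNz ?fcoefN fcoefMn. Qed.

End FpsRing.

Arguments fpsX {R}.

(* Sum of a possibly infinite family of series, taken coefficientwise; it is
   meaningful when the family is summable, i.e., when for each [n] only finitely
   many members have a nonzero coefficient of degree [n]. *)
Definition fps_summable (R : comUnitRingType) (I : choiceType)
    (A : set I) (F : I -> {fps R}) : Prop :=
  forall n, finite_set (A `&` [set i | fcoef (F i) n != 0])%classic.

Definition fps_sum (R : comUnitRingType) (I : choiceType)
    (A : set I) (F : I -> {fps R}) : {fps R} :=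
  Fps (fun n => \sum_(i \in A) fcoef (F i) n).

Local Notation q := (fpsX : {fps int}).

Definition MO_index (t : nat) : set (t.-tuple nat) :=
  [set s : t.-tuple nat | all (leq 1) s && sorted ltn s]%classic.

Arguments MO_index : clear implicits.

Definition MO_denom (a : int) (m : nat) : {fps int} :=
  1 + a%:~R * q ^+ m + q ^+ (2 * m).

Definition MO_term (a : int) (t : nat) (s : t.-tuple nat) : {fps int} :=
  q ^+ (\sum_(k < t) tnth s k) / \prod_(k < t) MO_denom a (tnth s k).

Definition MO_series (a : int) (t : nat) : {fps int} :=
  fps_sum (MO_index t) (@MO_term a t).

Definition MO (a : int) (t n : nat) : int := fcoef (MO_series a t) n.

(* [^-1] is the identity off units and [\sum_(i \in A)] is 0 on infinite
   supports; the next three lemmas show that neither default value is ever used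
   in [MO_series]. *)

Lemma MO_denom_unit (a : int) (m : nat) :
  (0 < m)%N -> MO_denom a m \is a GRing.unit.
Proof.
case: m => // m _; rewrite fps_unitE /MO_denom mulrzl !fcoefD fcoefMz !fcoefXn.
by rewrite mulnS /= mul0rz !addr0.
Qed.

Lemma MO_prod_unit (a : int) (t : nat) (s : t.-tuple nat) :
  MO_index t s -> \prod_(k < t) MO_denom a (tnth s k) \is a GRing.unit.
Proof.
move=> /andP[/all_tnthP s_gt0 _]; apply: rpred_prod => k _.
exact: MO_denom_unit.
Qed.

Lemma MO_summable (a : int) (t : nat) :
  fps_summable (MO_index t) (@MO_term a t).
Proof.
move=> n; pose T := [set: {ffun 'I_t -> 'I_n.+1}]%classic.
pose h (u : {ffun 'I_t -> 'I_n.+1}) : t.-tuple nat :=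
  [tuple of mktuple (fun k => u k : nat)].
apply: (@sub_finite_set _ _ (h @` T)%classic); last first.
  exact/finite_image/finite_finset.
move=> s [_ /= nz]; have le_sn : (\sum_(k < t) tnth s k <= n)%N.
  rewrite leqNgt; apply: contra nz => lt_ns.
  apply/eqP/big1 => i _; rewrite fcoefXn ltn_eqF ?mul0r //.
  by apply: leq_ltn_trans lt_ns; rewrite -ltnS.
exists [ffun k => inord (tnth s k)] => //; apply: eq_from_tnth => k.
rewrite tnth_mktuple ffunE inordK // ltnS; apply: leq_trans le_sn.
by rewrite (bigD1 k) //= leq_addr.
Qed.

(* Main.v *)
(* Summing over all [t] with a formal variable [z], the generating series is
   [\prod_n (1 + z q^n / (1 - q^n + q^(2n)))].  Since
   [(1 + q^n) (1 - q^n + q^(2n)) = 1 + q^(3n)], multiplying by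
   [\prod_n (1 + q^(3n))] turns it modulo 2 into
   [\prod_n (1 - q^n) (1 + (z - 1) q^n + q^(2n))], which the Jacobi triple
   product expands as [\sum_k q^(k (k + 1) / 2) C_k(z)], and k (k + 1) / 2 is never 2
   modulo 3.  Dividing by a series in q^3 preserves the vanishing of the
   coefficients of index 2 modulo 3.  Only coefficients up to a fixed index [M]
   matter, so the products are cut at [n <= M], and the triple product is
   replaced by its finite form, whose coefficients are q-binomials. *)

Require Import Defs.
From HB Require Import structures.
From mathcomp Require Import all_boot all_order all_algebra.
From mathcomp Require Import ring zify.
From mathcomp Require Import classical_sets functions fsbigop.

Set Implicit Arguments.
Unset Strict Implicit.
Unset Printing Implicit Defensive.

Import GRing.Theory.
Local Open Scope ring_scope.

(** * Gaussian binomials and the finite Jacobi triple product *)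

Section FiniteTripleProduct.
Variables (A : comUnitRingType) (q : A).

Definition qfact n : A := \prod_(i < n) (1 - q ^+ i.+1).

(** The Gaussian binomial of a + b over a. Indexing by the two parts keeps the symmetry visible and
    avoids truncated subtraction. *)
Definition qbin a b : A := qfact (a + b) / (qfact a * qfact b).

(* For [w = x + 1/x] this is [\sum_(0 <= i <= 2 k) (-1)^i x^(k - i)]. *)
Fixpoint altker (w : A) k : A :=
  match k with
  | 0 => 1
  | 1 => w - 1
  | (m.+1 as p).+1 => w * altker w p - altker w m
  end.

Lemma altker0 w : altker w 0 = 1.
Proof. by []. Qed.

(** The truncation [0.-1 = 0] gives the right value: the kernel is symmetric under k -> -1 - k, so
    its value at -1 is its value at 0. *)
Lemma mul_altker w k : w * altker w k = altker w k.+1 + altker w k.-1.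
Proof. by case: k => [|k] /=; rewrite ?mulr1 subrK. Qed.

Arguments altker : simpl never.

Lemma qfactS n : qfact n.+1 = qfact n * (1 - q ^+ n.+1).
Proof. by rewrite /qfact big_ord_recr. Qed.

(** The factors after the first a are all 1 modulo q^(a+1). Over a general ring [A] such a
    congruence is stated with a cofactor [h]. *)
Lemma qfact_split a n : exists h, qfact (a + n) = qfact a * (1 + q ^+ a.+1 * h).
Proof.
elim: n => [|n [h IHn]]; first by exists 0; rewrite addn0 mulr0 addr0 mulr1.
exists (h - q ^+ n - q ^+ a.+1 * q ^+ n * h).
by rewrite addnS qfactS IHn -addSn exprD; ring.
Qed.

Hypothesis q_unit : forall n, 1 - q ^+ n.+1 \is a GRing.unit.

Lemma qfact_unit n : qfact n \is a GRing.unit.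
Proof. by apply: rpred_prod => i _. Qed.

Lemma qbinE a b : qbin a b * (qfact a * qfact b) = qfact (a + b).
Proof. by rewrite divrK // unitrM !qfact_unit. Qed.

Lemma qbin_eq a b x : x * (qfact a * qfact b) = qfact (a + b) -> x = qbin a b.
Proof.
by rewrite -qbinE => /mulIr -> //; rewrite unitrM !qfact_unit.
Qed.

Lemma qbinC a b : qbin a b = qbin b a.
Proof. by rewrite /qbin addnC [qfact a * _]mulrC. Qed.

Lemma qbin0 b : qbin 0 b = 1.
Proof. by apply/esym/qbin_eq; rewrite /qfact big_ord0 !mul1r. Qed.

Lemma qbinSS a b : qbin a.+1 b.+1 = qbin a b.+1 + q ^+ a.+1 * qbin a.+1 b.
Proof.
apply/esym/qbin_eq.
(* With denominators cleared, what remains is 1 - q^(a+b+2) = (1 - q^(a+1)) + q^(a+1) (1 -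
   q^(b+1)). *)
have -> : (qbin a b.+1 + q ^+ a.+1 * qbin a.+1 b) * (qfact a.+1 * qfact b.+1) =
    qbin a b.+1 * (qfact a * qfact b.+1) * (1 - q ^+ a.+1) +
    q ^+ a.+1 * (qbin a.+1 b * (qfact a.+1 * qfact b)) * (1 - q ^+ b.+1).
  by rewrite !qfactS; ring.
have Eq : q ^+ (a + b).+2 = q ^+ a.+1 * q ^+ b.+1.
  by rewrite -exprD addSn addnS.
by rewrite !qbinE !addSn !addnS [qfact (a + b).+2]qfactS Eq; ring.
Qed.

Lemma qbinSSr a b : qbin a.+1 b.+1 = q ^+ b.+1 * qbin a b.+1 + qbin a.+1 b.
Proof. by rewrite qbinC qbinSS addrC ![qbin b.+1 _]qbinC [qbin b _]qbinC. Qed.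

(** Both q-Pascal rules combined; the three terms match those of the factor 1 + w q^n + q^(2n) in
    the induction on M. *)
Lemma qbin3 a b : qbin a.+2 b.+2 =
  (1 + q ^+ (a + b).+3) * qbin a.+1 b.+1 + q ^+ b.+2 * qbin a b.+2
  + q ^+ a.+2 * qbin a.+2 b.
Proof.
rewrite qbinSS qbinSSr [qbin a.+2 b.+1]qbinSSr.
have -> : (a + b).+3 = (a.+2 + b.+1)%N by lia.
by rewrite exprD; ring.
Qed.

(** The instance a = -1 of [qbin3], whose middle binomial is then absent. *)
Lemma qbin3_1 b :
  qbin 1 b.+2 = (1 + q ^+ b.+2) * qbin 0 b.+1 + q * qbin 1 b.
Proof.
by rewrite qbinSS qbinSSr !qbin0 [q ^+ b.+2]exprS expr1; ring.
Qed.

(** The binomial is 2M + 1 over M - k. The test on [k] is needed because for k > M the truncated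
    [M - k] would make it 1 instead of 0. *)
Definition jtp_coef M k : A :=
  if (k <= M)%N then q ^+ 'C(k.+1, 2) * qbin (M - k) (M + k).+1 else 0.

Lemma triangularS k : 'C(k.+2, 2) = ('C(k.+1, 2) + k.+1)%N.
Proof. by rewrite binS bin1. Qed.

(** The recurrence of [jtp_coefS] at index 0: by the symmetry k -> -1 - k, the neighbour of index -1
    is again [jtp_coef M 0]. *)
Lemma jtp_coef0 M : jtp_coef M.+1 0 =
  (1 + q ^+ (2 * M.+1)) * jtp_coef M 0
  + q ^+ M.+1 * jtp_coef M 0 + q ^+ M.+1 * jtp_coef M 1.
Proof.
rewrite /jtp_coef /= !subn0 !addn0 !expr0 !mul1r.
case: M => [|M] /=.
  by rewrite qbin3_1 [qbin 1 0]qbinC !qbin0 muln1 mulr0; ring.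
rewrite qbin3 [qbin M.+2 _]qbinC subn1 addn1 /=.
have -> : (2 * M.+2 = (M + M.+1).+3)%N by lia.
by rewrite [q ^+ M.+3]exprSr binn; ring.
Qed.

(** This is [qbin3] with a + 2 = M - k and b = M + k + 1; the triangular exponents turn its powers
    of q into q^(M+1). *)
Lemma jtp_coefS M k : jtp_coef M.+1 k.+1 =
  (1 + q ^+ (2 * M.+1)) * jtp_coef M k.+1
  + q ^+ M.+1 * jtp_coef M k + q ^+ M.+1 * jtp_coef M k.+2.
Proof.
rewrite /jtp_coef ltnS.
have [ltkM|ltMk|->] := ltngtP k M; last 2 first.
- by rewrite !ifN ?mulr0 ?addr0 // -ltnNge; lia.
- rewrite ltnNge leqnSn /= mulr0 add0r mulr0 addr0 !subnn !qbin0 !mulr1.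
  by rewrite triangularS exprD mulrC.
rewrite !triangularS !exprD; set u := q ^+ 'C(_, _).
have [M' EM] : exists M', M = (k + M').+1 by exists (M - k).-1; lia.
(* For k + 1 = M the term of index k + 2 is 0, and [qbin3_1] replaces [qbin3]. *)
case: M' EM => [|a] EM.
  rewrite ifN; last by lia.
  have -> : (M.+1 - k.+1 = 1)%N by lia.
  have -> : (M - k = 1)%N by lia.
  have -> : (M - k.+1 = 0)%N by lia.
  have -> : (M.+1 + k.+1).+1 = (M + k).+3 by lia.
  have -> : (M + k.+1).+1 = (M + k).+2 by lia.
  have -> : (2 * M.+1 = (M + k).+3)%N by lia.
  rewrite qbin3_1 (_ : M.+1 = k.+1 + 1)%N ?exprD ?expr1; last by lia.
  by ring.
have -> : (k.+1 < M)%N by lia.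
have -> : (M.+1 - k.+1 = a.+2)%N by lia.
have -> : (M - k = a.+2)%N by lia.
have -> : (M - k.+1 = a.+1)%N by lia.
have -> : (M - k.+2 = a)%N by lia.
have -> : (M.+1 + k.+1).+1 = (M + k).+3 by lia.
have -> : (M + k.+1).+1 = (M + k).+2 by lia.
have -> : (M + k.+2).+1 = (M + k).+3 by lia.
rewrite qbin3.
have -> : (2 * M.+1 = (a + (M + k).+1).+3)%N by lia.
have -> : q ^+ (M + k).+3 = q ^+ M.+1 * q ^+ k.+2.
  by rewrite -exprD; congr (_ ^+ _); lia.
have -> : q ^+ M.+1 = q ^+ a.+2 * q ^+ k.+1.
  by rewrite -exprD; congr (_ ^+ _); lia.
by ring.
Qed.

Lemma sum_mul_shift m (g h : nat -> A) : g m = 0 ->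
  \sum_(k < m) g k * h k =
  \sum_(k < m) g k.+1 * h k.+1 + g 0%N * h 0%N.
Proof.
move=> gm0; transitivity (\sum_(k < m.+1) g k * h k).
  by rewrite big_ord_recr /= gm0 mul0r addr0.
by rewrite big_ord_recl addrC.
Qed.

(* Up to division by [1 + 1/x], with [w = x + 1/x], this is the q-binomial
   theorem for [\prod_(1 <= n <= M) (1 + x q^n) *
   \prod_(0 <= n <= M) (1 + q^n / x)]. *)
Lemma finite_triple_product w M :
  \prod_(n < M) (1 + w * q ^+ n.+1 + q ^+ (2 * n.+1)) =
  \sum_(k < M.+1) jtp_coef M k * altker w k.
Proof.
elim: M => [|M IHM].
  by rewrite big_ord0 big_ord1 /jtp_coef /= qbin0 !mulr1.
rewrite big_ord_recr {}IHM [RHS]big_ord_recl /= jtp_coef0.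
under [in RHS]eq_bigr => k _ do rewrite /bump /= add1n jtp_coefS.
have vanish k : (M < k)%N -> jtp_coef M k = 0.
  by rewrite /jtp_coef ltnNge => /negbTE ->.
set X := q ^+ M.+1; set Y := q ^+ _; set b := jtp_coef M.
set S1 := \sum_(k < M.+1) b k * altker w k.
have E1 : \sum_(k < M.+1) b k.+1 * altker w k.+1 = S1 - b 0%N.
  by rewrite [S1]sum_mul_shift ?altker0 ?mulr1 ?addrK //; apply: vanish.
pose S2 := \sum_(k < M.+1) b k * altker w k.+1.
(* Indices 0 and 1 both meet [altker w 0], hence the two boundary terms. *)
have E3 : \sum_(k < M.+1) b k * altker w k.-1 =
    \sum_(k < M.+1) b k.+2 * altker w k.+1 + b 1%N + b 0%N.
  rewrite (@sum_mul_shift _ b (fun k => altker w k.-1)) /=; last exact: vanish.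
  rewrite (@sum_mul_shift _ (fun k => b k.+1)); last exact: vanish.
  by rewrite altker0 !mulr1.
have Ew : w * S1 = S2 + \sum_(k < M.+1) b k * altker w k.-1.
  rewrite /S1 /S2 big_distrr -big_split; apply: eq_bigr => k _ /=.
  by rewrite mulrCA mul_altker mulrDr.
have -> : \sum_(k < M.+1) ((1 + Y) * b k.+1 + X * b k + X * b k.+2)
      * altker w k.+1 =
    (1 + Y) * (S1 - b 0%N) + X * S2
    + X * (\sum_(k < M.+1) b k.+2 * altker w k.+1).
  rewrite -E1 /S2 !big_distrr -!big_split; apply: eq_bigr => k _ /=.
  by ring.
have -> : S1 * (1 + w * X + Y) = S1 * (1 + Y) + X * (w * S1) by ring.
by rewrite altker0 Ew E3; ring.
Qed.

(** The left side is q^(k(k+1)/2) times the quotients [qfact M / qfact (M - k)] and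
    [qfact (2M + 1) / qfact (M + k + 1)], both 1 modulo q^(M-k+1). Since k(k+1)/2 >= k, the error
    has order at least M + 1. *)
Lemma qfact_jtp_coef M k : (k <= M)%N ->
  exists h, qfact M * jtp_coef M k = q ^+ 'C(k.+1, 2) + q ^+ M.+1 * h.
Proof.
move=> lekM; rewrite /jtp_coef lekM.
have [h1 E1] := qfact_split (M - k) k.
have [h2 E2] := qfact_split (M + k).+1 (M - k).
rewrite subnK // in E1.
have EH : qfact M * qbin (M - k) (M + k).+1 =
    (1 + q ^+ (M - k).+1 * h1) * (1 + q ^+ (M + k).+2 * h2).
  have U : qfact (M - k) * qfact (M + k).+1 \is a GRing.unit.
    by rewrite unitrM !qfact_unit.
  by apply: (mulIr U); rewrite -mulrA qbinE addnC E2 E1; ring.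
have lekT : (k <= 'C(k.+1, 2))%N by case: (k) => // m; rewrite triangularS; lia.
have ET : q ^+ 'C(k.+1, 2) * q ^+ (M - k).+1 =
    q ^+ M.+1 * q ^+ ('C(k.+1, 2) - k).
  by rewrite -!exprD; congr (_ ^+ _); lia.
have EM : q ^+ (M + k).+2 = q ^+ (M - k).+1 * q ^+ (k + k).+1.
  by rewrite -exprD; congr (_ ^+ _); lia.
pose g := h1 + q ^+ (k + k).+1 * h2
  + q ^+ (M - k).+1 * q ^+ (k + k).+1 * h1 * h2.
exists (q ^+ ('C(k.+1, 2) - k) * g).
by rewrite mulrCA EH EM mulrA -ET /g; ring.
Qed.

(** Jacobi's triple product up to degree M, with the factor 1 + 1/x divided out. *)
Lemma triple_product_mod w M : exists h,
  qfact M * \prod_(n < M) (1 + w * q ^+ n.+1 + q ^+ (2 * n.+1)) =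
  \sum_(k < M.+1) q ^+ 'C(k.+1, 2) * altker w k + q ^+ M.+1 * h.
Proof.
rewrite finite_triple_product big_distrr /=.
apply: (big_ind2 (fun x y => exists h, x = y + q ^+ M.+1 * h)).
- by exists 0; rewrite mulr0 addr0.
- by move=> _ x _ y [h ->] [h' ->]; exists (h + h'); ring.
move=> k _; have [|h E] := @qfact_jtp_coef M k; first by rewrite -ltnS.
by exists (h * altker w k); rewrite mulrA E; ring.
Qed.

End FiniteTripleProduct.

(** * Power series in q^3 and residues of exponents modulo 3 *)

Section CubeSeries.
Variable R : comUnitRingType.
Implicit Types f g : {fps R}.
Local Notation q := (fpsX : {fps R}).

Lemma fcoef0 n : fcoef (0 : {fps R}) n = 0.
Proof. by []. Qed.

Lemma fcoef_sum I (r : seq I) (P : pred I) (F : I -> {fps R}) n :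
  fcoef (\sum_(i <- r | P i) F i) n = \sum_(i <- r | P i) fcoef (F i) n.
Proof.
exact: (big_morph (fun f => fcoef f n) (fun f g => fcoefD f g n) (fcoef0 n)).
Qed.

Lemma fcoefXnM m f n :
  fcoef (q ^+ m * f) n = if (m <= n)%N then fcoef f (n - m) else 0.
Proof.
rewrite fcoefM; case: ifP => lemn; last first.
  rewrite big1 // => i _; rewrite fcoefXn.
  case: eqP => [ei|]; last by rewrite mul0r.
  by have := ltn_ord i; rewrite ei ltnS lemn.
rewrite -ltnS in lemn; rewrite (bigD1 (Ordinal lemn)) //= big1 => [|i neqi].
  by rewrite fcoefXn eqxx mul1r addr0.
by rewrite fcoefXn (_ : (i == m :> nat) = false) ?mul0r //; apply/negbTE.
Qed.

Definition cube_series f := forall n, (n %% 3 != 0)%N -> fcoef f n = 0.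

Lemma cube_seriesD f g : cube_series f -> cube_series g -> cube_series (f + g).
Proof. by move=> Cf Cg n n3; rewrite fcoefD Cf // Cg // addr0. Qed.

Lemma cube_seriesN f : cube_series f -> cube_series (- f).
Proof. by move=> Cf n n3; rewrite fcoefN Cf // oppr0. Qed.

Lemma cube_series1 : cube_series 1.
Proof. by case. Qed.

Lemma cube_seriesXn m : cube_series (q ^+ (3 * m)).
Proof.
by move=> n; rewrite fcoefXn; case: (n =P _) => // ->; rewrite modnMr.
Qed.

Lemma cube_seriesM f g : cube_series f -> cube_series g -> cube_series (f * g).
Proof.
move=> Cf Cg n n3; rewrite fcoefM big1 // => i _.
have [i3|i3] := eqVneq (i %% 3)%N 0%N; last by rewrite Cf ?mul0r.
have lein : (i <= n)%N by rewrite -ltnS.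
by rewrite Cg ?mulr0 //; apply: contra n3; lia.
Qed.

Lemma cube_series_altker w k : cube_series w -> cube_series (altker w k).
Proof.
move=> Cw; suff [] : cube_series (altker w k) /\ cube_series (altker w k.+1).
  by [].
elim: k => [|k [IH1 IH2]].
  split; first exact: cube_series1.
  exact/cube_seriesD/cube_seriesN/cube_series1.
by split=> //; apply: cube_seriesD; [exact: cube_seriesM | exact: cube_seriesN].
Qed.

Lemma triangular_mod3 k : ('C(k.+1, 2) %% 3 != 2)%N.
Proof.
(* The residues repeat as 0, 1, 0; the induction needs this exact form. *)
suff : ('C(k.+1, 2) %% 3 = if k %% 3 == 1 then 1 else 0)%N.
  by case: ifP => _ ->.
by elim: k => // k IHk; rewrite triangularS; move: IHk; do !case: ifP; lia.
Qed.

Lemma cube_series_triple_product w M n :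
    cube_series w -> (n <= M)%N -> (n %% 3 = 2)%N ->
  fcoef (qfact q M * \prod_(i < M) (1 + w * q ^+ i.+1 + q ^+ (2 * i.+1))) n = 0.
Proof.
move=> Cw leNM n2.
have q_unit m : 1 - q ^+ m.+1 \is a GRing.unit.
  by rewrite fps_unitE fcoefD fcoefN fcoefXn fcoef1 /= subr0 unitr1.
have [h ->] := triple_product_mod q_unit w M.
(* The remainder starts in degree M + 1 > n. *)
rewrite fcoefD fcoefXnM ltnNge leNM addr0 fcoef_sum big1 // => k _.
rewrite fcoefXnM; case: ifP => // leTn; apply: cube_series_altker => //.
by have := triangular_mod3 k; lia.
Qed.

(** Strong induction on n: in the coefficient of f g at n, a term with i < n vanishes by induction
    if i is 2 modulo 3, and otherwise because 3 does not divide n - i. This leaves the coefficient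
    of f. *)
Lemma cube_series_cancel f g M : cube_series g -> fcoef g 0 = 1 ->
    (forall n, (n <= M)%N -> (n %% 3 = 2)%N -> fcoef (f * g) n = 0) ->
  forall n, (n <= M)%N -> (n %% 3 = 2)%N -> fcoef f n = 0.
Proof.
move=> Cg g1 fg0; elim/ltn_ind=> n IHn lenM n2.
rewrite -(fg0 n lenM n2) fcoefM big_ord_recr /= subnn g1 mulr1 big1 ?add0r //.
move=> i _; have lt_in := ltn_ord i.
have [i2|i2] := eqVneq (i %% 3)%N 2%N; first by rewrite IHn ?mul0r //; lia.
by rewrite Cg ?mulr0 //; lia.
Qed.

End CubeSeries.

(** * Coefficientwise ring morphisms and constant series *)

Section FpsMap.
Variables (R S : comUnitRingType) (phi : {rmorphism R -> S}).

Definition fps_map (f : {fps R}) : {fps S} := Fps (fun n => phi (fcoef f n)).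

Fact fps_map_is_zmod_morphism : zmod_morphism fps_map.
Proof. by move=> f g; apply: fpsP => n; rewrite /= rmorphB. Qed.

Fact fps_map_is_monoid_morphism : monoid_morphism fps_map.
Proof.
split=> [|f g]; apply: fpsP => n; first by rewrite /= rmorph_nat.
by rewrite /= rmorph_sum; apply: eq_bigr => i _; rewrite rmorphM.
Qed.

HB.instance Definition _ :=
  GRing.isZmodMorphism.Build {fps R} {fps S} fps_map fps_map_is_zmod_morphism.
HB.instance Definition _ :=
  GRing.isMonoidMorphism.Build {fps R} {fps S} fps_map
    fps_map_is_monoid_morphism.

Lemma fps_mapX : fps_map fpsX = fpsX.
Proof. by apply: fpsP => n; rewrite /= rmorph_nat. Qed.

End FpsMap.

Section FpsConst.
Variable R : comUnitRingType.

Definition fps_const (c : R) : {fps R} :=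
  Fps (fun n => if n == 0%N then c else 0).

Lemma fcoef_constM c f n : fcoef (fps_const c * f) n = c * fcoef f n.
Proof.
rewrite fcoefM big_ord_recl /= subn0 big1 ?addr0 // => i _.
by rewrite mul0r.
Qed.

Lemma fcoef_constXM c k f n :
  fcoef (fps_const c ^+ k * f) n = c ^+ k * fcoef f n.
Proof.
elim: k f => [|k IHk] f; first by rewrite !mul1r.
by rewrite !exprSr -!mulrA IHk fcoef_constM.
Qed.

End FpsConst.

(** * Reduction of the infinite sum to subsets of {1, ..., M} *)

Section PartialSums.
Variables (a : int) (M : nat).
Local Notation q := (fpsX : {fps int}).

Definition MO_factor m : {fps int} := q ^+ m / MO_denom a m.

Lemma MO_termE t (s : t.-tuple nat) : MO_index t s ->
  MO_term a s = \prod_(m <- s) MO_factor m.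
Proof.
move=> /andP[/all_tnthP s_gt0 _].
rewrite /MO_term big_tuple big_split /= prodrXr prodrV // => k _.
exact/MO_denom_unit/s_gt0.
Qed.

(* Junk value [nseq t 0] when [#|S| != t]. *)
Definition tuple_of_set t (S : {set 'I_M}) : t.-tuple nat :=
  insubd (nseq_tuple t 0%N) [seq i.+1 | i : 'I_M <- enum S].

Lemma tuple_of_setE t (S : {set 'I_M}) : #|S| = t ->
  tuple_of_set t S = [seq i.+1 | i : 'I_M <- enum S] :> seq nat.
Proof.
by move=> cS; rewrite /tuple_of_set val_insubd size_map -cardE cS eqxx.
Qed.

Lemma sorted_enum_set (S : {set 'I_M}) :
  sorted ltn [seq i.+1 | i : 'I_M <- enum S].
Proof.
rewrite sorted_map {1}/enum_mem; apply: sorted_filter.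
  by move=> x y z /=; apply: ltn_trans.
have : sorted ltn (map val (enum 'I_M)) by rewrite val_enum_ord iota_ltn_sorted.
by rewrite sorted_map enumT.
Qed.

Lemma tuple_of_set_bij (t : nat) : set_bij
  [set S : {set 'I_M} | #|S| == t]%classic
  (MO_index t `&` [set s : t.-tuple nat | all (leq^~ M) s])%classic
  (tuple_of_set t).
Proof.
split.
- move=> S /= /eqP cS; split; rewrite /MO_index /= tuple_of_setE //.
    by rewrite sorted_enum_set andbT all_map; apply/allP.
  by rewrite all_map; apply/allP => i _ /=.
- move=> S S'; rewrite !inE => /eqP cS /eqP cS'.
  move=> /(congr1 (@tval t nat)); rewrite !tuple_of_setE //.
  have succ_inj : injective (fun i : 'I_M => i.+1) by move=> x y [] /val_inj.
  move=> /(inj_map succ_inj) eqS; apply/setP => i.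
  by have := mem_enum S i; rewrite eqS mem_enum.
move=> s [/andP[s_gt0 s_sorted] /= s_le].
pose S := [set i : 'I_M | (i : nat).+1 \in (s : seq nat)].
have ES : [seq i.+1 | i : 'I_M <- enum S] = s.
  (* Strictly increasing lists with the same members are equal. *)
  apply: (irr_sorted_eq ltn_trans ltnn) => //; first exact: sorted_enum_set.
  move=> m; apply/mapP/idP => [[i]|ms]; first by rewrite mem_enum inE => ? ->.
  have := allP s_gt0 _ ms; have := allP s_le _ ms; case: m ms => // m ms ltmM _.
  by exists (Ordinal ltmM); rewrite // mem_enum inE.
have cS : #|S| = t.
  by rewrite cardE -(size_map (fun i : 'I_M => i.+1)) ES size_tuple.
exists S; first by rewrite /= cS.
by apply: val_inj; rewrite /= tuple_of_setE.
Qed.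

Lemma MO_sum_sets t : MO a t M =
  \sum_(S : {set 'I_M} | #|S| == t) fcoef (\prod_(i in S) MO_factor i.+1) M.
Proof.
rewrite /MO /MO_series /=.
have -> : \sum_(s \in MO_index t) fcoef (MO_term a s) M =
  \sum_(s \in
    (MO_index t `&` [set s : t.-tuple nat | all (leq^~ M) s])%classic)
    fcoef (MO_term a s) M.
  (* A tuple with an entry above M has sum above M, so its term has no coefficient of degree M. *)
  apply/esym/fsbig_widen => [s []//|s [s_idx s_big]].
  change (fcoef (MO_term a s) M = 0); rewrite /MO_term fcoefXnM.
  rewrite ifN //; apply: contra_notN s_big => le_sM; split=> //=.
  apply/all_tnthP => k; apply: leq_trans le_sM.
  by rewrite (bigD1 k) //= leq_addr.
rewrite (reindex_fsbig (tuple_of_set t) _ _ _ (tuple_of_set_bij t)).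
rewrite (@bigfs _ _ _ _ (index_enum {set 'I_M})) //; last first.
- by move=> S _; rewrite mem_index_enum.
- exact: index_enum_uniq.
apply: eq_fsbigr => S; rewrite inE => /eqP cS.
have [inS _ _] := tuple_of_set_bij t.
have [|S_idx _] := inS S; first by rewrite /= cS.
by rewrite MO_termE // tuple_of_setE // big_map big_enum.
Qed.

End PartialSums.

(** * Reduction modulo 2 and the generating series in z *)

Section Parity.
Local Notation R2 := {poly 'F_2}.
Local Notation A := {fps R2}.
Local Notation q := (fpsX : A).
(** The variable marking t lives in the coefficient ring, so one series in q over F_2[z] handles all
    t at once. *)
Local Notation z := (fps_const 'X : A).
Local Notation red := (fps_map (intr : {rmorphism int -> R2})).

Lemma two_eq0 : 2%:R = 0 :> A.
Proof.
apply: fpsP => n; rewrite fcoefMn.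
have /pcharf0 E : 2%N \in [pchar R2] by rewrite pchar_poly pchar_Fp.
by rewrite -mulr_natl E mul0r.
Qed.

Lemma qfact_pchar2 M : qfact q M = \prod_(i < M) (1 + q ^+ i.+1).
Proof.
apply: eq_bigr => i _; congr (_ + _).
by apply/eqP; rewrite eq_sym -subr_eq0 opprK -mulr2n -mulr_natl two_eq0 mul0r.
Qed.

Lemma red_MO_factor m : (0 < m)%N ->
  red (MO_factor (-1) m) * (1 + (-1) * q ^+ m + q ^+ (2 * m)) = q ^+ m.
Proof.
move=> m_gt0; have := MO_denom_unit (-1) m_gt0; set d := MO_denom _ _ => Ud.
have <- : red d = 1 + (-1) * q ^+ m + q ^+ (2 * m).
  by rewrite /d /MO_denom !rmorphD rmorph1 rmorphM rmorph_int
    !rmorphXn /= fps_mapX mulrN1z.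
by rewrite -rmorphM divrK // rmorphXn /= fps_mapX.
Qed.

(** Factor by factor, with u = q^n and f the reduced factor: 1 + u^3 = (1 + u)(1 - u + u^2) and f (1
    - u + u^2) = u. Characteristic 2 enters only in identifying the product of the 1 + u with
    [qfact q M]. *)
Lemma prod_MO_factor M :
  \prod_(i < M) (z * red (MO_factor (-1) i.+1) + 1)
    * \prod_(i < M) (1 + q ^+ (3 * i.+1)) =
  qfact q M * \prod_(i < M) (1 + (z - 1) * q ^+ i.+1 + q ^+ (2 * i.+1)).
Proof.
rewrite qfact_pchar2 -!big_split; apply: eq_bigr => i _ /=.
have := @red_MO_factor i.+1 isT; rewrite !exprM.
rewrite ![q ^+ _ ^+ i.+1]exprAC; set u := q ^+ i.+1; set f := red _ => E.
have -> : 1 + u ^+ 3 = (1 + u) * (1 + -1 * u + u ^+ 2) by ring.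
by rewrite mulrCA; congr (_ * _); rewrite mulrDl mul1r -mulrA E; ring.
Qed.

Lemma cube_series_const c : cube_series (fps_const c : A).
Proof. by case. Qed.

Lemma generating_coef_eq0 M : (M %% 3 = 2)%N ->
  fcoef (\prod_(i < M) (z * red (MO_factor (-1) i.+1) + 1)) M = 0.
Proof.
move=> M2; pose g : A := \prod_(i < M) (1 + q ^+ (3 * i.+1)).
have [Cg g1] : cube_series g /\ fcoef g 0 = 1.
  apply: (big_ind (fun g : A => cube_series g /\ fcoef g 0 = 1)).
  - by split; first exact: cube_series1.
  - move=> f h [Cf f1] [Ch h1]; split; first exact: cube_seriesM.
    by rewrite fcoefM big_ord1 f1 h1 mulr1.
  move=> i _; split; last by rewrite fcoefD fcoefXn fcoef1 mulnS addr0.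
  by apply: cube_seriesD; [exact: cube_series1 | exact: cube_seriesXn].
apply: (cube_series_cancel Cg g1) (leqnn M) M2 => n lenM n2.
rewrite prod_MO_factor cube_series_triple_product //.
apply: cube_seriesD; first exact: cube_series_const.
exact/cube_seriesN/cube_series1.
Qed.

Lemma generating_coefE M :
  fcoef (\prod_(i < M) (z * red (MO_factor (-1) i.+1) + 1)) M =
  \sum_(S : {set 'I_M})
    'X^#|S| * (fcoef (\prod_(i in S) MO_factor (-1) i.+1) M)%:~R.
Proof.
rewrite bigA_distr fcoef_sum; apply: eq_bigr => S _.
rewrite -big_mkcond big_split prodr_const fcoef_constXM; congr (_ * _).
by rewrite -rmorph_prod.
Qed.

Lemma MO_parity t M : (M %% 3 = 2)%N -> (2 %| MO (-1) t M)%Z.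
Proof.
(* The coefficient of z^t selects the subsets of size t, whose sum is [MO (-1) t M] modulo 2. *)
move=> /generating_coef_eq0; rewrite generating_coefE => /polyP /(_ t).
rewrite coef0 coef_sum.
rewrite (dvdz_pcharf (pchar_Fp (isT : prime 2))) MO_sum_sets rmorph_sum /=.
move=> E; apply/eqP; rewrite -[RHS]E big_mkcond; apply: eq_bigr => S _ /=.
rewrite coefXnM eq_sym -[_%:~R : R2](rmorph_int polyC) coefC.
by case: ltngtP => [|ltSt|->]; rewrite ?subnn ?eqxx // subn_eq0 leqNgt ltSt.
Qed.

End Parity.

Theorem theorem4p1 (t N : nat) (ht : (1 <= t)%N) :
  (MO (-1)%R t (3 * N + 2)%N = 0%R %[mod 2])%Z.
Proof.
apply/eqP; rewrite eqz_mod_dvd subr0; apply: MO_parity.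
by rewrite mulnC modnMDl.
Qed.
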